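(* Assume there is $\lambda>0$ with $J(0;u_1,0)\ge\lambda\,\mathbb{E}\int_0^T|u_1(s)|^2ds$ for all $u_1\in\mathcal{U}_1$, and there is $\lambda>0$ with $J(0;0,u_2)\le-\lambda\,\mathbb{E}\int_0^T|u_2(s)|^2ds$ for all $u_2\in\mathcal{U}_2$. Define $$\Phi=R_2+D_2^\top(P_1-\Sigma)D_2-D_2^\top(P_1-\Sigma)D_1[R_1+D_1^\top(P_1-\Sigma)D_1]^{-1}D_1^\top(P_1-\Sigma)D_2,$$ $$\widehat\Phi=\mathcal{R}^{-1}+\mathcal{R}^{-1}\mathcal{S}_2\widehat\Sigma^{-1}\Sigma\mathcal{S}_2^\top\mathcal{R}^{-1}.$$ Then the matrix-valued function $\Phi$ is invertible with its inverse given by $\Phi^{-1}=\widehat\Phi$.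
   Context: Setting. $T>0$; $(\Omega,\mathcal{F},\mathbb{P})$ is a complete probability space carrying a one-dimensional standard Brownian motion $W$, and $\mathbb{F}=\{\mathcal{F}_t\}$ is the usual augmentation of the natural filtration of $W$. $\mathbb{S}^n$ denotes the real symmetric $n\times n$ matrices, $\mathbb{S}^n_-$ the negative semidefinite ones. For a measurable symmetric-matrix-valued $F$ on $[0,T]$, $F\gg0$ means $F(s)\ge\delta I$ for a.e. $s$ for some $\delta>0$; $F\ll0$ means $-F\gg0$. Deterministic data: $A,C\in L^\infty(0,T;\mathbb{R}^{n\times n})$, $B_i,D_i\in L^\infty(0,T;\mathbb{R}^{n\times m_i})$, $Q\in L^\infty(0,T;\mathbb{S}^n)$, $R_i\in L^\infty(0,T;\mathbb{S}^{m_i})$ ($i=1,2$), $G\in\mathbb{S}^n$. $\mathcal{U}_i$ is the space of $\mathbb{F}$-progressively measurable $\varphi:[0,T]\times\Omega\to\mathbb{R}^{m_i}$ with $\mathbb{E}\int_0^T|\varphi|^2ds<\infty$. For $x\in\mathbb{R}^n$, $u_i\in\mathcal{U}_i$, the state $X$ solves $$dX=[AX+B_1u_1+B_2u_2]ds+[CX+D_1u_1+D_2u_2]dW,\quad X(0)=x,$$ and $$J(x;u_1,u_2)=\mathbb{E}\Big\{\langle GX(T),X(T)\rangle+\int_0^T\big[\langle QX,X\rangle+\langle R_1u_1,u_1\rangle+\langle R_2u_2,u_2\rangle\big]ds\Big\}.$$ Time arguments are suppressed; identities between matrix-valued functions hold a.e. on $[0,T]$. The functions $P_1$ and $\Sigma$.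 When $u_1\mapsto J(0;u_1,0)$ is uniformly convex as assumed in the claim, it is known that $$\dot P_1+P_1A+A^\top P_1+C^\top P_1C+Q-(P_1B_1+C^\top P_1D_1)(R_1+D_1^\top P_1D_1)^{-1}(B_1^\top P_1+D_1^\top P_1C)=0,\quad P_1(T)=G,$$ has a unique strongly regular solution $P_1\in C([0,T];\mathbb{S}^n)$, i.e. a solution with $R_1+D_1^\top P_1D_1\gg0$. Put $\widehat R_1=R_1+D_1^\top P_1D_1$, $\mathcal{A}=(P_1B_1+C^\top P_1D_1)\widehat R_1^{-1}B_1^\top-A^\top$, $\mathcal{C}=(P_1B_1+C^\top P_1D_1)\widehat R_1^{-1}D_1^\top-C^\top$, $\mathcal{B}=\mathcal{C}P_1D_2-P_1B_2$, $\mathcal{R}=D_2^\top P_1D_2-D_2^\top P_1D_1\widehat R_1^{-1}D_1^\top P_1D_2+R_2$, $\mathcal{Q}=-B_1\widehat R_1^{-1}B_1^\top$, $\mathcal{N}=-D_1\widehat R_1^{-1}D_1^\top$, $\mathcal{S}_3=-D_1\widehat R_1^{-1}B_1^\top$, $\mathcal{S}_2=D_2^\top-D_2^\top P_1D_1\widehat R_1^{-1}D_1^\top$, $\mathcal{S}_1=B_2^\top-D_2^\top P_1D_1\widehat R_1^{-1}B_1^\top$. $\Sigma\in C([0,T];\mathbb{S}^n_-)$ is the unique negative semidefinite solution of $$\begin{cases}\dot\Sigma-\Sigma\mathcal{A}^\top-\mathcal{A}\Sigma+\Sigma\mathcal{S}_1^\top\mathcal{R}^{-1}\mathcal{B}^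\top+\mathcal{B}\mathcal{R}^{-1}\mathcal{S}_1\Sigma+\Sigma\mathcal{S}_1^\top\mathcal{R}^{-1}\mathcal{S}_1\Sigma-\Sigma\mathcal{Q}\Sigma+\mathcal{B}\mathcal{R}^{-1}\mathcal{B}^\top\\\quad+[\mathcal{C}-\mathcal{B}\mathcal{R}^{-1}\mathcal{S}_2-\Sigma\mathcal{S}_1^\top\mathcal{R}^{-1}\mathcal{S}_2+\Sigma\mathcal{S}_3^\top][I+\Sigma\mathcal{N}-\Sigma\mathcal{S}_2^\top\mathcal{R}^{-1}\mathcal{S}_2]^{-1}\\\quad\times\Sigma[\mathcal{C}^\top-\mathcal{S}_2^\top\mathcal{R}^{-1}\mathcal{B}^\top-\mathcal{S}_2^\top\mathcal{R}^{-1}\mathcal{S}_1\Sigma+\mathcal{S}_3\Sigma]=0,\quad t\in[0,T],\\ \Sigma(T)=0,\end{cases}$$ and $\widehat\Sigma=I+\Sigma\mathcal{N}-\Sigma\mathcal{S}_2^\top\mathcal{R}^{-1}\mathcal{S}_2$. Under the assumptions of the claim, $\mathcal{R}\ll0$, $\Sigma$ exists and is unique, $\widehat\Sigma^{-1}\in L^\infty(0,T;\mathbb{R}^{n\times n})$, $\widehat\Sigma^{-1}\Sigma\in L^\infty(0,T;\mathbb{S}^n)$, and (since $\Sigma\le0$) $R_1+D_1^\top(P_1-\Sigma)D_1\gg0$. *)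

(* Defs.v *)
From mathcomp Require Import all_boot all_order all_algebra.
From mathcomp Require Import all_classical all_reals all_analysis.

Set Implicit Arguments.
Unset Strict Implicit.
Unset Printing Implicit Defensive.

Import Order.TTheory GRing.Theory Num.Theory.
Import numFieldNormedType.Exports.

Local Open Scope classical_set_scope.
Local Open Scope ring_scope.

Section Deterministic.
Context {R : realType}.
Implicit Types T : R.

Definition dotv n (x y : 'cV[R]_n) : R := (x^T *m y) 0 0.

Definition symmx n (M : 'M[R]_n) : Prop := M^T = M.

Definition psdmx n (M : 'M[R]_n) : Prop :=
  symmx M /\ forall v : 'cV[R]_n, 0 <= dotv (M *m v) v.

Definition ae_on T (p : R -> Prop) : Prop :=
  {ae @lebesgue_measure R, forall s, s \in `[0, T] -> p s}.

Definition Linfty T p q (F : R -> 'M[R]_(p, q)) : Prop :=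
  (forall i j, measurable_fun (`[0, T] : set (measurableTypeR R))
     (fun s => F s i j)) /\
  (exists K : R, ae_on T (fun s => forall i j, `|F s i j| <= K)).

(* F >> 0 *)
Definition unif_pos T n (F : R -> 'M[R]_n) : Prop :=
  exists2 delta : R, 0 < delta & ae_on T (fun s => psdmx (F s - delta%:M)).

Definition mxcontinuous T p q (F : R -> 'M[R]_(p, q)) : Prop :=
  forall i j, {within `[0, T], continuous (fun s => F s i j)}.

(* The disjoint subintervals ]u k, v k[ of [a, b] are listed from left to
   right. *)
Definition abs_continuous (a b : R) (f : R -> R) : Prop :=
  forall e : R, 0 < e -> exists2 delta : R, 0 < delta &
    forall (N : nat) (u v : nat -> R),
      (forall k, (k < N)%N -> a <= u k /\ u k <= v k /\ v k <= b) ->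
      (forall k, (k.+1 < N)%N -> v k <= u k.+1) ->
      \sum_(k < N) (v k - u k) < delta ->
      \sum_(k < N) `|f (v k) - f (u k)| < e.

Definition mxderive p q (F : R -> 'M[R]_(p, q)) (s : R) : 'M[R]_(p, q) :=
  \matrix_(i, j) derive1 (fun r => F r i j) s.

(* The coefficients are only measurable, so F' + f(s, F) = 0 is understood in
   the sense of Caratheodory: F is absolutely continuous and the equation holds
   at almost every time. *)
Definition ode_solution T p q (f : R -> 'M[R]_(p, q) -> 'M[R]_(p, q))
    (F : R -> 'M[R]_(p, q)) : Prop :=
  (forall i j, abs_continuous 0 T (fun s => F s i j)) /\
  ae_on T (fun s => (forall i j, derivable (fun r => F r i j) s 1) /\
                    mxderive F s + f s (F s) = 0).

Record lq_data (n m1 m2 : nat) := LQData {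
  cA : R -> 'M[R]_n; cC : R -> 'M[R]_n;
  cB1 : R -> 'M[R]_(n, m1); cB2 : R -> 'M[R]_(n, m2);
  cD1 : R -> 'M[R]_(n, m1); cD2 : R -> 'M[R]_(n, m2);
  cQ : R -> 'M[R]_n; cR1 : R -> 'M[R]_m1; cR2 : R -> 'M[R]_m2;
  cG : 'M[R]_n }.

Section LQ.
Variables (n m1 m2 : nat) (dt : lq_data n m1 m2).

Definition lq_data_ok T : Prop :=
  [/\ Linfty T (cA dt) /\ Linfty T (cC dt),
      Linfty T (cB1 dt) /\ Linfty T (cB2 dt),
      Linfty T (cD1 dt) /\ Linfty T (cD2 dt),
      [/\ Linfty T (cQ dt), Linfty T (cR1 dt) & Linfty T (cR2 dt)] &
      ae_on T (fun s => [/\ symmx (cQ dt s), symmx (cR1 dt s)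
                          & symmx (cR2 dt s)]) /\ symmx (cG dt)].

Local Notation A := (cA dt).
Local Notation C := (cC dt).
Local Notation B1 := (cB1 dt).
Local Notation B2 := (cB2 dt).
Local Notation D1 := (cD1 dt).
Local Notation D2 := (cD2 dt).
Local Notation Q := (cQ dt).
Local Notation R1 := (cR1 dt).
Local Notation R2 := (cR2 dt).
Local Notation G := (cG dt).

Definition riccati1 (s : R) (P : 'M[R]_n) : 'M[R]_n :=
  P *m A s + (A s)^T *m P + (C s)^T *m P *m C s + Q s
  - (P *m B1 s + (C s)^T *m P *m D1 s)
    *m invmx (R1 s + (D1 s)^T *m P *m D1 s)
    *m ((B1 s)^T *m P + (D1 s)^T *m P *m C s).

Variable P1 : R -> 'M[R]_n.

Definition Rhat1 (s : R) : 'M[R]_m1 := R1 s + (D1 s)^T *m P1 s *m D1 s.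

Definition strongly_regular_solution T : Prop :=
  [/\ mxcontinuous T P1, forall s, s \in `[0, T] -> symmx (P1 s),
      ode_solution T riccati1 P1, P1 T = G & unif_pos T Rhat1].

Definition calA (s : R) : 'M[R]_n :=
  (P1 s *m B1 s + (C s)^T *m P1 s *m D1 s) *m invmx (Rhat1 s) *m (B1 s)^T
  - (A s)^T.

Definition calC (s : R) : 'M[R]_n :=
  (P1 s *m B1 s + (C s)^T *m P1 s *m D1 s) *m invmx (Rhat1 s) *m (D1 s)^T
  - (C s)^T.

Definition calB (s : R) : 'M[R]_(n, m2) :=
  calC s *m P1 s *m D2 s - P1 s *m B2 s.

Definition calR (s : R) : 'M[R]_m2 :=
  (D2 s)^T *m P1 s *m D2 s
  - (D2 s)^T *m P1 s *m D1 s *m invmx (Rhat1 s) *m (D1 s)^T *m P1 s *m D2 s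
  + R2 s.

Definition calQ (s : R) : 'M[R]_n := - (B1 s *m invmx (Rhat1 s) *m (B1 s)^T).

Definition calN (s : R) : 'M[R]_n := - (D1 s *m invmx (Rhat1 s) *m (D1 s)^T).

Definition calS3 (s : R) : 'M[R]_n := - (D1 s *m invmx (Rhat1 s) *m (B1 s)^T).

Definition calS2 (s : R) : 'M[R]_(m2, n) :=
  (D2 s)^T - (D2 s)^T *m P1 s *m D1 s *m invmx (Rhat1 s) *m (D1 s)^T.

Definition calS1 (s : R) : 'M[R]_(m2, n) :=
  (B2 s)^T - (D2 s)^T *m P1 s *m D1 s *m invmx (Rhat1 s) *m (B1 s)^T.

Definition Sigmahat_of (s : R) (S : 'M[R]_n) : 'M[R]_n :=
  1%:M + S *m calN s - S *m (calS2 s)^T *m invmx (calR s) *m calS2 s.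

Definition riccati_Sigma (s : R) (S : 'M[R]_n) : 'M[R]_n :=
  - (S *m (calA s)^T) - calA s *m S
  + S *m (calS1 s)^T *m invmx (calR s) *m (calB s)^T
  + calB s *m invmx (calR s) *m calS1 s *m S
  + S *m (calS1 s)^T *m invmx (calR s) *m calS1 s *m S
  - S *m calQ s *m S
  + calB s *m invmx (calR s) *m (calB s)^T
  + (calC s - calB s *m invmx (calR s) *m calS2 s
     - S *m (calS1 s)^T *m invmx (calR s) *m calS2 s + S *m (calS3 s)^T)
    *m invmx (Sigmahat_of s S)
    *m S
    *m ((calC s)^T - (calS2 s)^T *m invmx (calR s) *m (calB s)^T
        - (calS2 s)^T *m invmx (calR s) *m calS1 s *m S + calS3 s *m S).

Variable Sigma : R -> 'M[R]_n.

Definition Sigmahat (s : R) : 'M[R]_n := Sigmahat_of s (Sigma s).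

(* invmx is total (invmx M = M for singular M), so the equation only means what
   it should when the two matrices inverted in it are invertible; this is part
   of being a solution. *)
Definition nsd_Sigma_solution T : Prop :=
  [/\ mxcontinuous T Sigma,
      forall s, s \in `[0, T] -> psdmx (- Sigma s),
      ae_on T (fun s => calR s \in unitmx /\ Sigmahat s \in unitmx),
      ode_solution T riccati_Sigma Sigma & Sigma T = 0].

Definition Phi (s : R) : 'M[R]_m2 :=
  R2 s + (D2 s)^T *m (P1 s - Sigma s) *m D2 s
  - (D2 s)^T *m (P1 s - Sigma s) *m D1 s
    *m invmx (R1 s + (D1 s)^T *m (P1 s - Sigma s) *m D1 s)
    *m (D1 s)^T *m (P1 s - Sigma s) *m D2 s.

Definition Phihat (s : R) : 'M[R]_m2 :=
  invmx (calR s)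
  + invmx (calR s) *m calS2 s *m invmx (Sigmahat s) *m Sigma s
    *m (calS2 s)^T *m invmx (calR s).

End LQ.
End Deterministic.

Section Stochastic.
Context {R : realType} {d : measure_display} {Omega : measurableType d}.
Variables (P : probability Omega R) (W : R -> Omega -> R) (T : R).
Local Notation mu := (@lebesgue_measure R).

(* Generators of the sigma-algebra of (W r)_(0 <= r <= s). *)
Definition past (s : R) : set (set Omega) :=
  [set E | exists r : R, exists B : set (measurableTypeR R),
     [/\ 0 <= r, r <= s, measurable B & E = W r @^-1` B]].

Definition standard_BM : Prop :=
  [/\ forall t, 0 <= t -> measurable_fun setT (W t),
      {ae P, forall w, W 0 w = 0},
      forall s t (E : set Omega) (B : set (measurableTypeR R)),
        0 <= s -> s < t -> <<s past s >> E -> measurable B ->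
        let F := (fun w => W t w - W s w) @^-1` B in
        P (E `&` F) = (P E * P F)%E,
      forall s t (B : set (measurableTypeR R)),
        0 <= s -> s < t -> measurable B ->
        P ((fun w => W t w - W s w) @^-1` B)
          = normal_prob 0 (Num.sqrt (t - s)) B
      & {ae P, forall w, {within `[0, +oo[, continuous (W ^~ w)}}].

(* Usual augmentation: null sets are added, then the right limit is taken. *)
Definition filtr (t : R) : set (set Omega) :=
  [set E | forall s, t < s ->
     <<s past s `|` [set N | P.-negligible N] >> E].

Definition prog_measurable (phi : R -> Omega -> R) : Prop :=
  forall t, t \in `[0, T] ->
    measurable_fun
      (`[0, t] `*` setT
         : set (measurableTypeR R * g_sigma_algebraType (filtr t))%type)
      (fun z => phi z.1 z.2).

Definition energy m (u : R -> Omega -> 'cV[R]_m) : \bar R :=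
  (\int[P]_w \int[mu]_(s in `[0%R, T]) (dotv (u s w) (u s w))%:E)%E.

Definition L2prog m (u : R -> Omega -> 'cV[R]_m) : Prop :=
  (forall i, prog_measurable (fun s w => u s w i 0)) /\ (energy u < +oo)%E.

(* The process equal to sp_xi i on ]sp_t i, sp_t i.+1], for i < sp_n. *)
Record simple_process := SimpleProcess {
  sp_n : nat; sp_t : nat -> R; sp_xi : nat -> Omega -> R }.

Definition simple_process_ok (S : simple_process) : Prop :=
  forall i, (i < sp_n S)%N ->
    [/\ 0 <= sp_t S i, sp_t S i <= sp_t S i.+1, sp_t S i.+1 <= T,
        forall B : set (measurableTypeR R), measurable B ->
          filtr (sp_t S i) (sp_xi S i @^-1` B)
        & exists K : R, forall w, `|sp_xi S i w| <= K].

Definition simple_val (S : simple_process) (s : R) (w : Omega) : R :=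
  \sum_(i < sp_n S) sp_xi S i w * ((sp_t S i < s) && (s <= sp_t S i.+1))%:R.

Definition simple_ito (S : simple_process) (t : R) (w : Omega) : R :=
  \sum_(i < sp_n S)
    sp_xi S i w * (W (Num.min (sp_t S i.+1) t) w - W (Num.min (sp_t S i) t) w).

(* I is a version of the Ito integral of H against W over [0, t]. *)
Definition is_ito (H : R -> Omega -> R) (t : R) (I : Omega -> R) : Prop :=
  measurable_fun setT I /\
  exists S : nat -> simple_process,
    [/\ forall k, simple_process_ok (S k),
        (fun k => \int[P]_w \int[mu]_(s in `[0%R, T])
            ((H s w - simple_val (S k) s w) ^+ 2)%:E)%E @ \oo --> 0%E
      & (fun k => \int[P]_w ((I w - simple_ito (S k) t w) ^+ 2)%:E)%E
          @ \oo --> 0%E].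

Variables (n m1 m2 : nat) (dt : @lq_data R n m1 m2).

Definition is_state (x : 'cV[R]_n) (u1 : R -> Omega -> 'cV[R]_m1)
    (u2 : R -> Omega -> 'cV[R]_m2) (X : R -> Omega -> 'cV[R]_n) : Prop :=
  let drift s w :=
    cA dt s *m X s w + cB1 dt s *m u1 s w + cB2 dt s *m u2 s w in
  let diffusion s w :=
    cC dt s *m X s w + cD1 dt s *m u1 s w + cD2 dt s *m u2 s w in
  [/\ L2prog X,
      {ae P, forall w, mxcontinuous T (X ^~ w)}
    & forall t i, t \in `[0, T] ->
        exists2 I : Omega -> R,
          is_ito (fun s w => diffusion s w i 0) t I
          & {ae P, forall w, X t w i 0 =
               x i 0 + Rintegral mu `[0, t] (fun s => drift s w i 0) + I w}].

(* J(x; u1, u2) is cost u1 u2 X for the state X of (x, u1, u2), which is unique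
   up to indistinguishability. *)
Definition cost (u1 : R -> Omega -> 'cV[R]_m1)
    (u2 : R -> Omega -> 'cV[R]_m2) (X : R -> Omega -> 'cV[R]_n) : \bar R :=
  (\int[P]_w ((dotv (cG dt *m X T w) (X T w))%:E +
     \int[mu]_(s in `[0%R, T])
       (dotv (cQ dt s *m X s w) (X s w)
        + dotv (cR1 dt s *m u1 s w) (u1 s w)
        + dotv (cR2 dt s *m u2 s w) (u2 s w))%:E))%E.

Definition null_control m : R -> Omega -> 'cV[R]_m := fun _ _ => 0.

Definition convex_in_u1 : Prop :=
  exists2 lambda : R, 0 < lambda &
    forall u1 X, L2prog u1 -> is_state 0 u1 (@null_control _) X ->
      (lambda%:E * energy u1 <= cost u1 (@null_control _) X)%E.

Definition concave_in_u2 : Prop :=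
  exists2 lambda : R, 0 < lambda &
    forall u2 X, L2prog u2 -> is_state 0 (@null_control _) u2 X ->
      (cost (@null_control _) u2 X <= - (lambda%:E * energy u2))%E.

End Stochastic.

(* Main.v *)
Require Import Defs.
From mathcomp Require Import all_boot all_order all_algebra.
From mathcomp Require Import all_classical all_reals all_analysis.

(** The claim is pointwise in time.  Fix a time and put X = D1 Rhat1^-1 D1^T,
    M = Rhat1 - D1^T Sigma D1 and Y = D1 M^-1 D1^T.  Since Rhat1 >> 0 and
    Sigma <= 0, M is invertible, and the resolvent identity gives
    X Sigma Y = Y - X = Y Sigma X.  Hence 1 - Sigma X has inverse
    1 + Sigma Y, and Phi = calR - calS2 (1 - Sigma X)^-1 Sigma calS2^T is a Schur
    complement whose counterpart is
    Sigmahat = (1 - Sigma X) - Sigma calS2^T calR^-1 calS2; the formula for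
    Phi^-1 is then the Woodbury identity. *)

Import Order.TTheory GRing.Theory Num.Theory.
Import numFieldNormedType.Exports.

Local Open Scope classical_set_scope.
Local Open Scope ring_scope.

Section NoncommutativeIdentities.
Variables (A : pzRingType) (P S X Y : A).
Hypotheses (hXY : X * S * Y = Y - X) (hYX : Y * S * X = Y - X).

Lemma resolvent_inverse : (1 - S * X) * (1 + S * Y) = 1.
Proof.
rewrite mulrBl mul1r mulrDr mulr1 -mulrA [X * _]mulrA hXY mulrBr.
by rewrite [S * X + _]addrC subrK addrK.
Qed.

(** [hXY] collapses [(1 - P * X) * (1 + S * Y)] to [1 - (P - S) * Y], and [hYX] then evaluates the
    product with the last [X], after which all terms in [X] cancel. Between [D2^T] and [D2], the
    right side is [Phi] without [R2]. *)
Lemma schur_complement_resolvent :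
  P - P * X * P - (1 - P * X) * ((1 + S * Y) * S) * (1 - X * P)
  = (P - S) - (P - S) * Y * (P - S).
Proof.
have E : (1 - P * X) * (1 + S * Y) = 1 - (P - S) * Y.
  rewrite [LHS]mulrBl mul1r mulrDr mulr1 -[P * X * (S * Y)]mulrA.
  rewrite [X * (S * Y)]mulrA hXY mulrBr [P * X + _]addrC subrK.
  by rewrite mulrBl opprB addrA.
have -> : (1 - P * X) * ((1 + S * Y) * S) = S - (P - S) * Y * S.
  by rewrite mulrA E [LHS]mulrBl mul1r.
have F : (S - (P - S) * Y * S) * X = P * X - (P - S) * Y.
  rewrite [LHS]mulrBl -!(mulrA (P - S)) hYX mulrBr opprB addrA.
  by rewrite [(P - S) * X]mulrBl [S * X + _]addrC subrK.
rewrite [_ * (1 - X * P)]mulrBr mulr1 mulrA F.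
rewrite [(_ - _ * Y) * P]mulrBl [(P - S) * Y * (P - S)]mulrBr.
set U := P * X * P; set V := _ * Y * S; set Z := _ * Y * P.
by rewrite !opprB !addrA addrNK addrAC [P - Z - S]addrAC [LHS]addrAC.
Qed.

End NoncommutativeIdentities.

(** Multiply out. With [Z] the matrix [L - V *m invmx K *m U] and [W = V *m invmx K], the quadratic
    term contains [L' *m (L - Z) *m invmx Z], which is [invmx Z - L']; the two remaining correction
    terms cancel it. *)
Lemma woodbury (R : comUnitRingType) (n m : nat) (K : 'M[R]_m) (U : 'M[R]_(m, n))
    (V : 'M[R]_(n, m)) (L L' : 'M[R]_n) :
    K \in unitmx -> L - V *m invmx K *m U \in unitmx -> L' *m L = 1%:M ->
  (K - U *m L' *m V) *m
  (invmx K + invmx K *m U *m invmx (L - V *m invmx K *m U) *m V *m invmx K)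
  = 1%:M.
Proof.
move=> Ku; set Z := L - _ => Zu L'L.
set W := V *m invmx K in Z Zu *.
have WU : W *m U = L - Z by rewrite /Z subKr.
have mid : L' *m (W *m U) *m invmx Z = invmx Z - L'.
  by rewrite WU mulmxBr L'L mulmxBl mul1mx mulmxK.
have -> : invmx K + invmx K *m U *m invmx Z *m V *m invmx K
    = invmx K *m (1%:M + U *m invmx Z *m W).
  by rewrite mulmxDr mulmx1 /W !mulmxA.
rewrite mulmxA mulmxBl mulmxV // -(mulmxA _ V) -/W.
rewrite mulmxBl mul1mx mulmxDr mulmx1.
have -> : U *m L' *m W *m (U *m invmx Z *m W)
    = U *m (L' *m (W *m U) *m invmx Z) *m W by rewrite !mulmxA.
by rewrite mid mulmxBr mulmxBl [_ + (_ - _)]addrC subrK addrK.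
Qed.

Lemma resolvent_identity (R : comUnitRingType) (m : nat) (K M : 'M[R]_m) :
    K \in unitmx -> M \in unitmx ->
  invmx K *m (K - M) *m invmx M = invmx M - invmx K.
Proof.
by move=> Ku Mu; rewrite mulmxBr mulVmx // mulmxBl mul1mx mulmxK.
Qed.

(** [S2'] plays the transpose of [S2]. Written out separately, it leaves a purely algebraic
    statement; symmetry enters only when the two are identified for the actual data. *)
Lemma schur_complement_inverse (R : comUnitRingType) (n m1 m2 : nat)
    (D1 : 'M[R]_(n, m1)) (D2 : 'M[R]_(n, m2)) (R2 : 'M[R]_m2) (P S : 'M[R]_n)
    (K M : 'M[R]_m1) :
    K - D1^T *m S *m D1 = M -> K \in unitmx -> M \in unitmx ->
  let S2 := D2^T - D2^T *m P *m D1 *m invmx K *m D1^T in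
  let S2' := D2 - D1 *m invmx K *m D1^T *m P *m D2 in
  let Rc := D2^T *m P *m D2 - D2^T *m P *m D1 *m invmx K *m D1^T *m P *m D2 + R2 in
  let Z := 1%:M + S *m (- (D1 *m invmx K *m D1^T)) - S *m S2' *m invmx Rc *m S2 in
    Rc \in unitmx -> Z \in unitmx ->
  (R2 + D2^T *m (P - S) *m D2
   - D2^T *m (P - S) *m D1 *m invmx M *m D1^T *m (P - S) *m D2) *m
  (invmx Rc + invmx Rc *m S2 *m invmx Z *m S *m S2' *m invmx Rc) = 1%:M.
Proof.
move=> hM Ku Mu S2 S2' Rc Z Rcu.
pose X : 'M[R]_n := D1 *m invmx K *m D1^T.
pose Y : 'M[R]_n := D1 *m invmx M *m D1^T.
have hKM : D1^T *m S *m D1 = K - M by rewrite -hM subKr.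
have hXY : X * S * Y = Y - X.
  rewrite -!mulmxE /X /Y -mulmxBl -mulmxBr -resolvent_identity // -hKM.
  by rewrite !mulmxA.
(* The resolvent identity with [K] and [M] exchanged: both sides change sign. *)
have hYX : Y * S * X = Y - X.
  rewrite -!mulmxE /X /Y -mulmxBl -mulmxBr.
  rewrite -[invmx M - _]opprB -resolvent_identity // -mulNmx -mulmxN opprB -hKM.
  by rewrite !mulmxA.
have ZE : Z = (1 - S * X) - (S *m S2') *m invmx Rc *m S2.
  by rewrite /Z mulmxN.
rewrite ZE => Zu.
have S2E : S2 = D2^T *m (1 - P * X).
  by rewrite /S2 mulmxBr mulmx1 -mulmxE /X !mulmxA.
have S2E' : S2' = (1 - X * P) *m D2.
  by rewrite /S2' mulmxBl mul1mx -mulmxE.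
have RcE : Rc = D2^T *m (P - P * X * P) *m D2 + R2.
  by rewrite /Rc mulmxBr mulmxBl -!mulmxE /X !mulmxA.
(* This is the shape [K - U *m L' *m V] of [woodbury], with [L' = 1 + S * Y], [L = 1 - S * X] and
   the factor [S] absorbed into [V = S *m S2']. *)
have -> : R2 + D2^T *m (P - S) *m D2
   - D2^T *m (P - S) *m D1 *m invmx M *m D1^T *m (P - S) *m D2
   = Rc - S2 *m (1 + S * Y) *m (S *m S2').
  have -> : S2 *m (1 + S * Y) *m (S *m S2')
      = D2^T *m ((1 - P * X) * ((1 + S * Y) * S) * (1 - X * P)) *m D2.
    by rewrite S2E S2E' -!mulmxE !mulmxA.
  rewrite RcE [RHS]addrAC -[in RHS]mulmxBl -[in RHS]mulmxBr schur_complement_resolvent //.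
  rewrite [in RHS]mulmxBr [in RHS]mulmxBl [RHS]addrC [RHS]addrA.
  by rewrite -!mulmxE /Y !mulmxA.
rewrite -(mulmxA _ S S2').
apply: woodbury => //.
(* [resolvent_inverse] gives the product in the other order; square matrices allow the swap. *)
by rewrite mulmxE; apply/mulmx1C/resolvent_inverse.
Qed.

Section Positivity.
Context {R : realType}.

Lemma dotv_gt0 (n : nat) (v : 'cV[R]_n) : v != 0 -> 0 < dotv v v.
Proof.
move=> v0; rewrite /dotv mxE lt_def; apply/andP; split; last first.
  by apply: sumr_ge0 => i _; rewrite mxE -expr2 sqr_ge0.
apply: contra_neq v0 => /eqP; rewrite psumr_eq0; last first.
  by move=> i _; rewrite mxE -expr2 sqr_ge0.
move=> /allP v0; apply/colP => i; rewrite mxE; apply/eqP.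
by have := v0 i (mem_index_enum i); rewrite /= mxE mulf_eq0 orbb.
Qed.

Lemma dotvN (n : nat) (x z : 'cV[R]_n) : dotv (- x) z = - dotv x z.
Proof. by rewrite /dotv linearN mulNmx mxE. Qed.

Lemma dotvB (n : nat) (x y z : 'cV[R]_n) :
  dotv (x - y) z = dotv x z - dotv y z.
Proof. by rewrite /dotv linearB mulmxBl !mxE. Qed.

Lemma dotvZ (n : nat) (a : R) (x z : 'cV[R]_n) : dotv (a *: x) z = a * dotv x z.
Proof. by rewrite /dotv linearZ -scalemxAl mxE. Qed.

(** A nonzero kernel vector would make the quadratic form vanish, against coercivity. *)
Lemma coercive_unitmx (n : nat) (M : 'M[R]_n) (delta : R) : 0 < delta ->
  (forall v : 'cV[R]_n, delta * dotv v v <= dotv (M *m v) v) -> M \in unitmx.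
Proof.
move=> d0 hM; rewrite -unitmx_tr -row_free_unit -kermx_eq0.
apply/rowV0P => u /sub_kermxP uM.
apply/eqP; rewrite -trmx_eq0; apply/negPn/negP => /dotv_gt0 u0.
have := hM u^T; rewrite {2}/dotv trmx_mul trmxK uM mul0mx mxE.
by rewrite leNgt mulr_gt0.
Qed.

(** As [S] is negative semidefinite, subtracting its congruence can only raise the quadratic form,
    so the bound [delta] survives. *)
Lemma psd_sub_congr_unitmx (n m : nat) (K : 'M[R]_m) (D : 'M[R]_(n, m))
    (S : 'M[R]_n) (delta : R) : 0 < delta ->
  psdmx (K - delta%:M) -> psdmx (- S) -> K - D^T *m S *m D \in unitmx.
Proof.
move=> d0 [_ hK] [_ hS]; apply: (coercive_unitmx _ _ _ d0) => v.
have := hK v; have := hS (D *m v).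
rewrite mulNmx dotvN !mulmxBl !dotvB mul_scalar_mx dotvZ subr_ge0 oppr_ge0.
have -> : dotv (D^T *m S *m D *m v) v = dotv (S *m (D *m v)) (D *m v).
  by rewrite /dotv !trmx_mul trmxK !mulmxA.
move=> hSv hKv; apply: (le_trans hKv).
by rewrite lerBrDr gerDl.
Qed.

End Positivity.

Theorem lemma5p4 (R : realType) (T : R) (hT : 0 < T)
    (d : measure_display) (Omega : measurableType d) (P : probability Omega R)
    (hP : measure_is_complete P)
    (W : R -> Omega -> R) (hW : standard_BM P W)
    (n m1 m2 : nat) (dt : @lq_data R n m1 m2) (hdt : lq_data_ok dt T)
    (hconvex : convex_in_u1 P W T dt)
    (hconcave : concave_in_u2 P W T dt)
    (P1 : R -> 'M[R]_n) (hP1 : strongly_regular_solution dt P1 T)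
    (Sigma : R -> 'M[R]_n) (hSigma : nsd_Sigma_solution dt P1 Sigma T) :
  ae_on T (fun s => Phi dt P1 Sigma s \in unitmx /\
                    invmx (Phi dt P1 Sigma s) = Phihat dt P1 Sigma s).
Proof.
case: hP1 => _ symP _ _ [delta d0 hR]; case: hSigma => _ hS hu _ _.
rewrite /ae_on in hR hu *; move: hR hu.
apply: (@filterS2 _ _ (ae_filter_ringOfSetsType (@lebesgue_measure R))).
move=> s hR hu sT.
have [Rcu Zu] := hu sT; have {}hR := hR sT; have {}hS := hS s sT.
have {}symP : (P1 s)^T = P1 s := symP s sT.
have Mu := psd_sub_congr_unitmx _ _ _ (cD1 dt s) _ _ d0 hR hS.
have Ku : Rhat1 dt P1 s \in unitmx.
  (* The case [S = 0] gives invertibility of [Rhat1] itself. *)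
  have S0 : psdmx (- 0 : 'M[R]_n).
    split=> [|v]; rewrite ?/symmx oppr0 ?trmx0 //.
    by rewrite /dotv mul0mx trmx0 mul0mx mxE.
  by have := psd_sub_congr_unitmx _ _ _ (cD1 dt s) _ _ d0 hR S0;
    rewrite mulmx0 mul0mx subr0.
(* [psdmx] includes symmetry, and the scalar shift by [delta] preserves it. *)
have symK : (Rhat1 dt P1 s)^T = Rhat1 dt P1 s.
  by case: hR => + _; rewrite /symmx linearB /= tr_scalar_mx => /addIr.
have S2T : (calS2 dt P1 s)^T = cD2 dt s
    - cD1 dt s *m invmx (Rhat1 dt P1 s) *m (cD1 dt s)^T *m P1 s *m cD2 dt s.
  by rewrite /calS2 linearB /= !trmx_mul !trmxK trmx_inv symK symP !mulmxA.
pose M := cR1 dt s + (cD1 dt s)^T *m (P1 s - Sigma s) *m cD1 dt s.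
have hM : Rhat1 dt P1 s - (cD1 dt s)^T *m Sigma s *m cD1 dt s = M.
  by rewrite /M mulmxBr mulmxBl addrA.
rewrite hM in Mu.
have := schur_complement_inverse _ _ _ _ _ (cD2 dt s) (cR2 dt s) (P1 s) _ _ _
  hM Ku Mu Rcu.
rewrite -S2T => /(_ Zu) PhiK.
(* For square matrices the one-sided identity [PhiK] already yields invertibility and determines the
   inverse. *)
have [Phiu _] := mulmx1_unit PhiK; split=> //.
by rewrite -[LHS]mulmx1 -PhiK mulKmx.
Qed.
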